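(* A permutation $\sigma\in S_n$ is smooth if and only if for every partition $\mathfrak{X}$ of $[n]$ the set $$\{\tau\in S_{\mathfrak{X}}:\tau\le\sigma\}$$ admits a maximum (greatest element) $\sigma_{\mathfrak{X}}$ with respect to $\le_{\mathfrak{X}}$. Moreover, in this case $\sigma_{\mathfrak{X}}$ is $\mathfrak{X}$-smooth for every partition $\mathfrak{X}$ of $[n]$.
   Context: $S_n$ is the group of permutations of $[n]=\{1,\dots,n\}$, $n\ge1$, with the Bruhat order $\le$: $\tau\le\sigma$ iff $\#(\tau([i])\cap[j])\ge\#(\sigma([i])\cap[j])$ for all $i,j\in[n]$. A permutation $\sigma$ is smooth if $\#\{i<j:\sigma(i)>\sigma(j)\}$ equals the number of transpositions $T\in S_n$ with $T\le\sigma$ (equivalently, as is known, $\sigma$ avoids the patterns $4231$ and $3412$). For a partition $\mathfrak{X}$ of $[n]$ (set of equivalence classes of an equivalence relation), $S_{\mathfrak{X}}$ is the subgroup of $\tau\in S_n$ with $\tau(X)=X$ for every $X\in\mathfrak{X}$. For $X\in\mathfrak{X}$ let $\eta_X:[\#X]\to X$ be the order preserving bijection, and identify $S_{\mathfrak{X}}$ with $\prod_{X\in\mathfrak{X}}S_{\#X}$ via $\tau\mapsto(\eta_X^{-1}\circ\tau|_X\circ\eta_X)_{X\in\mathfrak{X}}$. The partial order $\le_{\mathfrak{X}}$ on $S_{\mathfrak{X}}$ is the product, under this identification, of the Bruhat orders on the groups $S_{\#X}$. An element of $S_{\mathfrak{X}}$ is $\mathfrak{X}$-smooth if all its coordinates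 in $S_{\#X}$, $X\in\mathfrak{X}$, are smooth. *)

(* Defs.v *)
From mathcomp Require Import all_boot all_fingroup.
Set Implicit Arguments.
Unset Strict Implicit.
Unset Printing Implicit Defensive.

(* The set [n] = {1, ..., n} is represented by 'I_n = {0, ..., n-1}; thus
   [i] with i in [n] becomes {k : 'I_n | k <= i} with i : 'I_n. *)
Definition segment (n : nat) (i : 'I_n) : {set 'I_n} :=
  [set k : 'I_n | k <= i].

Definition bruhat (n : nat) (tau sigma : 'S_n) : bool :=
  [forall i : 'I_n, forall j : 'I_n,
    #|(sigma @: segment i) :&: segment j| <=
    #|(tau @: segment i) :&: segment j|].

Definition inversions (n : nat) (sigma : 'S_n) : {set 'I_n * 'I_n} :=
  [set p : 'I_n * 'I_n | (p.1 < p.2) && (sigma p.2 < sigma p.1)].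

Definition transpositions (n : nat) : {set 'S_n} :=
  [set tperm p.1 p.2 | p : 'I_n * 'I_n & p.1 != p.2].

Definition smooth (n : nat) (sigma : 'S_n) : bool :=
  #|inversions sigma| == #|[set T in transpositions n | bruhat T sigma]|.

Definition block_group (n : nat) (P : {set {set 'I_n}}) : {set 'S_n} :=
  [set tau : 'S_n | [forall X in P, tau @: X == X]].

Definition eta (n : nat) (X : {set 'I_n}) : 'I_#|X| -> 'I_n := @enum_val _ (mem X).

Lemma eta_in (n : nat) (X : {set 'I_n}) (a : 'I_#|X|) : eta a \in X.
Proof. exact: enum_valP. Qed.

Lemma eta_bij (n : nat) (X : {set 'I_n}) :
  injective (@eta n X) /\ (forall x, x \in X -> exists a : 'I_#|X|, eta a = x).
Proof.
split=> [|x xX]; first exact: enum_val_inj.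
by exists (enum_rank_in xX x); exact: enum_rankK_in.
Qed.

Lemma eta_mono (n : nat) (X : {set 'I_n}) (a b : 'I_#|X|) :
  (eta a < eta b) = (a < b).
Proof.
have lt_eta (c d : 'I_#|X|) : c < d -> eta c < eta d.
  move=> cd; rewrite /eta !(enum_val_nth (eta c)).
  have srt : sorted (relpre val ltn) (enum X).
    apply: sorted_filter; first by move=> x y z; apply: ltn_trans.
    by rewrite -enumT -sorted_map val_enum_ord iota_ltn_sorted.
  apply: (sorted_ltn_nth _ (eta c) srt) => //; first by move=> x y z; apply: ltn_trans.
  - by rewrite inE -cardE.
  - by rewrite inE -cardE.
apply/idP/idP=> [ab|]; last exact: lt_eta.
rewrite ltnNge leq_eqVlt; apply/negP=> /orP[/eqP/val_inj ba | /lt_eta ba].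
  by rewrite ba ltnn in ab.
by have := ltn_trans ab ba; rewrite ltnn.
Qed.

Section Coordinate.
Variables (n : nat) (X : {set 'I_n}) (tau : 'S_n).

(* restr_perm X tau agrees with tau on X when tau stabilises X, and is the
   identity otherwise; it makes the coordinate a total function of tau. *)
Definition coord_fun (a : 'I_#|X|) : 'I_#|X| :=
  enum_rank_in (eta_in a) (restr_perm X tau (eta a)).

Lemma eta_coord_fun (a : 'I_#|X|) :
  eta (coord_fun a) = restr_perm X tau (eta a).
Proof.
apply: enum_rankK_in.
by rewrite (perm_closed _ (restr_perm_on X tau)) eta_in.
Qed.

Lemma coord_fun_inj : injective coord_fun.
Proof.
move=> a b /(congr1 (@eta n X)); rewrite !eta_coord_fun => /perm_inj.
exact: enum_val_inj.
Qed.

Definition coord : 'S_#|X| := perm coord_fun_inj.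

Lemma coordE (a : 'I_#|X|) : tau @: X = X -> eta (coord a) = tau (eta a).
Proof.
move=> tauX; rewrite permE eta_coord_fun restr_permE ?eta_in //.
apply/astabsP=> x; rewrite /= apermE -{1}tauX mem_imset //.
exact: perm_inj.
Qed.

End Coordinate.

Definition block_le (n : nat) (P : {set {set 'I_n}}) (tau sigma : 'S_n) : bool :=
  [forall X in P, bruhat (coord X tau) (coord X sigma)].

Definition block_smooth (n : nat) (P : {set {set 'I_n}}) (sigma : 'S_n) : bool :=
  [forall X in P, smooth (coord X sigma)].

Definition is_block_max (n : nat) (P : {set {set 'I_n}}) (sigma mu : 'S_n) : Prop :=
  [/\ mu \in block_group P, bruhat mu sigma &
      forall tau : 'S_n, tau \in block_group P -> bruhat tau sigma ->
        block_le P tau mu].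

(* Main.v *)
Require Import Defs.
From mathcomp Require Import all_boot all_fingroup.
From mathcomp Require Import zify.
Set Implicit Arguments.
Unset Strict Implicit.
Unset Printing Implicit Defensive.

(* Write M_i and M'_i for the maxima of sigma and of sigma^-1 over [0, i]. A
   permutation below sigma has its graph in the staircase region
   { (i, j) | j <= M_i, i <= M'_j }, and a transposition (i j) with i < j is
   below sigma iff j <= M_i and j <= M'_i. Hence the number of transpositions
   below sigma is the weight sum_i (min (M_i, M'_i) - i).

   Call a pair of staircase functions (f, g) good if j <= f i and j <= g i with
   i <= j force f i = f j or g i = g j. Goodness passes to restrictions to
   subsets. Deleting the largest value shows by induction that sigma never has
   more inversions than its weight, and that equality makes (M, M') good.
   Conversely, the permutations in the region of a good pair have a Bruhat
   maximum, whose number of inversions is the weight, which is smooth, and which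
   is the only permutation in the region with that many inversions. So a smooth
   sigma is the maximum of its region, "tau <= sigma" is a condition on the graph
   of tau that can be checked block by block, and restricting the region to the
   blocks yields smooth maxima.

   If all block maxima exist, a failure of goodness is refuted by two cycles, and
   it remains to see that every permutation in the region of sigma is below
   sigma. By induction on its support this reduces to the maximum nu of a
   restricted region, and then to nu being a single cycle. Each nu * (p q)
   with (p, q) an inversion of nu splits into two orbits, so it is below sigma;
   this bounds the rank function of sigma except at points inside all inversions
   of nu, and there the absence of the pattern 3412 in nu suffices. *)

(** * Rank functions and the Bruhat order *)

Definition rank_in (n : nat) (X : {set 'I_n}) (s : 'S_n) (a b : nat) : nat :=
  #|[set k in X | (k < a) && (s k < b)]|.

Definition rank (n : nat) (s : 'S_n) (a b : nat) : nat := rank_in setT s a b.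

Definition upper_in (n : nat) (X : {set 'I_n}) (s : 'S_n) (a b : nat) :=
  [set k in X | (k < a) && (b <= s k)].

Definition lower_in (n : nat) (X : {set 'I_n}) (s : 'S_n) (a b : nat) :=
  [set k in X | (a <= k) && (s k < b)].

Definition below (n : nat) (X : {set 'I_n}) (a : nat) : nat :=
  #|[set k in X | k < a]|.

Section Ranks.
Variable n : nat.
Implicit Types (X : {set 'I_n}) (s t : 'S_n) (a b : nat).

Lemma card_sum_in X (P : pred 'I_n) :
  #|[set k in X | P k]| = \sum_(k in X) P k.
Proof.
rewrite -sum1_card big_mkcond /= [RHS]big_mkcond /=; apply: eq_bigr => k _.
by rewrite inE; case: (k \in X) => //=; case: (P k).
Qed.

Lemma rank_in_upper X s a b : rank_in X s a b + #|upper_in X s a b| = below X a.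
Proof.
rewrite /rank_in /upper_in /below !card_sum_in -big_split /=.
apply: eq_bigr => k _; lia.
Qed.

Lemma rank_in_lower X s a b : s @: X = X ->
  rank_in X s a b + #|lower_in X s a b| = below X b.
Proof.
move=> sX; rewrite /rank_in /lower_in /below !card_sum_in -big_split /=.
rewrite -{2}sX big_imset /=; last by move=> ? ? _ _ /perm_inj.
apply: eq_bigr => k _; lia.
Qed.

Lemma imset_setT s : s @: [set: 'I_n] = setT.
Proof.
apply/setP=> k; rewrite inE; apply/imsetP; exists ((s^-1)%g k) => //.
by rewrite permKV.
Qed.

Lemma below_setT a : below [set: 'I_n] a = minn a n.
Proof.
rewrite /below card_sum_in (eq_bigl xpredT); last by move=> k; rewrite inE.
elim: n => [|m IH]; first by rewrite big_ord0; lia.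
rewrite big_ord_recr /= IH; lia.
Qed.

Lemma below_ordE X (x : 'I_n) : below X x + (x \in X) = below X x.+1.
Proof.
rewrite /below !card_sum_in.
case: (boolP (x \in X)) => xX.
  rewrite (bigD1 x) //= [RHS](bigD1 x) //= ltnn ltnSn add0n addnC.
  congr (_ + _); apply: eq_bigr => k /andP[_]; rewrite -val_eqE /=; lia.
rewrite addn0; apply: eq_bigr => k kX; have : k != x by apply: contraNneq xX => <-.
rewrite -val_eqE /=; lia.
Qed.

Lemma rank_inV X s a b : s @: X = X -> rank_in X s^-1 a b = rank_in X s b a.
Proof.
move=> sX; rewrite /rank_in !card_sum_in -{1}sX big_imset /=; last first.
  by move=> ? ? _ _ /perm_inj.
by apply: eq_bigr => k _; rewrite permK andbC.
Qed.

Lemma rankV s a b : rank s^-1 a b = rank s b a.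
Proof. exact/rank_inV/imset_setT. Qed.

Lemma rank_upper s a b : rank s a b + #|upper_in setT s a b| = minn a n.
Proof. by rewrite -below_setT; exact: rank_in_upper. Qed.

Lemma rank_lower s a b : rank s a b + #|lower_in setT s a b| = minn b n.
Proof. by rewrite -below_setT; apply/rank_in_lower/imset_setT. Qed.

Lemma card_bruhat s (i j : 'I_n) :
  #|(s @: segment i) :&: segment j| = rank s i.+1 j.+1.
Proof.
rewrite /rank /rank_in -[RHS](card_imset _ (@perm_inj _ s)).
congr #|pred_of_set _|; apply/setP=> k; rewrite !inE; apply/andP/imsetP.
  by case=> /imsetP[l]; rewrite inE => li -> sl; exists l; rewrite // !inE ltnS li.
case=> l; rewrite !inE !ltnS /= => /andP[li sl] ->; split=> //.
by apply/imsetP; exists l; rewrite // inE.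
Qed.

Lemma rank_minn s a b : rank s a b = rank s (minn a n) (minn b n).
Proof.
rewrite /rank /rank_in; congr #|pred_of_set _|; apply/setP=> k; rewrite !inE /=.
by have := ltn_ord k; have := ltn_ord (s k); lia.
Qed.

Lemma rank0 s a b : a = 0 \/ b = 0 -> rank s a b = 0.
Proof. by move=> ab; have := rank_upper s a b; have := rank_lower s a b; lia. Qed.

(** [bruhat] only tests ranks at arguments from 1 to [n]; larger arguments truncate to [n], and a
    zero argument gives rank 0. *)
Lemma bruhatP t s :
  reflect (forall a b, rank s a b <= rank t a b) (bruhat t s).
Proof.
apply: (iffP idP) => [ts a b|H].
  rewrite (rank_minn s) (rank_minn t).
  case: (posnP (minn a n)) => [->|a0]; first by rewrite !rank0; auto.
  case: (posnP (minn b n)) => [->|b0]; first by rewrite !rank0; auto.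
  have ha : (minn a n).-1 < n by lia.
  have hb : (minn b n).-1 < n by lia.
  move/forallP/(_ (Ordinal ha))/forallP/(_ (Ordinal hb)): ts.
  by rewrite !card_bruhat /= !prednK.
by apply/forallP=> i; apply/forallP=> j; rewrite !card_bruhat.
Qed.

Lemma bruhat_refl s : bruhat s s.
Proof. exact/bruhatP. Qed.

Lemma bruhat_trans t u s : bruhat t u -> bruhat u s -> bruhat t s.
Proof.
by move=> /bruhatP tu /bruhatP us; apply/bruhatP=> a b; apply: leq_trans (tu a b).
Qed.

Lemma bruhatV t s : bruhat t s -> bruhat t^-1 s^-1.
Proof. by move=> /bruhatP ts; apply/bruhatP=> a b; rewrite !rankV. Qed.

Lemma rank_step s (k : 'I_n) b : rank s k b + (s k < b) = rank s k.+1 b.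
Proof.
rewrite /rank /rank_in !card_sum_in (bigD1 k) ?inE //= [RHS](bigD1 k) ?inE //=.
rewrite ltnn ltnSn /= add0n addnC; congr (_ + _); apply: eq_bigr => l /andP[_].
by rewrite -val_eqE /= => nk; lia.
Qed.

Lemma bruhat_anti t s : bruhat t s -> bruhat s t -> t = s.
Proof.
move=> /bruhatP ts /bruhatP st; have E a b : rank t a b = rank s a b.
  by apply/eqP; rewrite eqn_leq ts st.
have lt_eq (k : 'I_n) b : (t k < b) = (s k < b).
  have := rank_step t k b; have := rank_step s k b; rewrite !E; lia.
apply/permP=> k; apply/val_inj => /=.
have := lt_eq k (t k); have := lt_eq k (t k).+1; lia.
Qed.

End Ranks.

(** * Inversions, staircases and their regions *)

Definition inv_count (n : nat) (s : 'S_n) : nat :=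
  \sum_(i < n) \sum_(j < n) ((i < j) && (s j < s i)).

Definition prefix_max (n : nat) (s : 'S_n) (i : nat) : nat :=
  \max_(k < n | k <= i) s k.

Definition stair (n : nat) (f : nat -> nat) : Prop :=
  (forall i, i < n -> i <= f i < n) /\
  (forall i j, i <= j -> j < n -> f i <= f j).

Definition good (n : nat) (f g : nat -> nat) : Prop :=
  forall i j, i <= j -> j < n -> j <= f i -> j <= g i -> f i = f j \/ g i = g j.

Definition fits (n : nat) (f g : nat -> nat) (s : 'S_n) : Prop :=
  forall k : 'I_n, s k <= f k /\ k <= g (s k).

Definition weight (n : nat) (f g : nat -> nat) : nat :=
  \sum_(i < n) (minn (f i) (g i) - i).

(** * Inserting and deleting the largest value *)

Section Lift.
Variable n : nat.
Implicit Types (d p : 'I_n.+1) (s t : 'S_n).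

Lemma val_lift_max (k : 'I_n) : lift ord_max k = k :> nat.
Proof. by rewrite /= /bump; have := ltn_ord k; lia. Qed.

Lemma val_lift_perm d s (k : 'I_n) :
  lift_perm d ord_max s (lift d k) = s k :> nat.
Proof. by rewrite lift_perm_lift val_lift_max. Qed.

Lemma val_lift_permV d s (k : 'I_n) :
  (lift_perm d ord_max s)^-1%g (lift ord_max k) = bump d (s^-1%g k) :> nat.
Proof. by rewrite lift_permV lift_perm_lift. Qed.

Lemma lift_or d k : (exists l : 'I_n, k = lift d l) \/ k = d.
Proof. by case: (unliftP d k) => [l ->|->]; [left; exists l | right]. Qed.

Lemma exists_lift_perm (p q : 'I_n.+1) (t : 'S_n.+1) :
  t p = q -> exists t' : 'S_n, t = lift_perm p q t'.
Proof.
(* The default [k] never occurs: [t (lift p k)] differs from [t p = q]. *)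
move=> tp; pose h k := odflt k (unlift q (t (lift p k))).
have hE k : lift q (h k) = t (lift p k).
  rewrite /h; case: unliftP => [j -> //|/eqP].
  by rewrite -tp (inj_eq perm_inj) eq_sym (negbTE (neq_lift p k)).
have h_inj : injective h.
  by move=> k l /(congr1 (lift q)); rewrite !hE => /perm_inj /lift_inj.
exists (perm h_inj); apply/permP=> k; case: (unliftP p k) => [j ->|->].
  by rewrite lift_perm_lift permE hE.
by rewrite lift_perm_id.
Qed.

Lemma rank_lift d s a b : b <= n ->
  rank (lift_perm d ord_max s) a b = rank s (a - (d < a)) b.
Proof.
move=> bn; rewrite /rank /rank_in !card_sum_in.
rewrite (eq_bigl xpredT) => [|k]; last by rewrite inE.
rewrite [RHS](eq_bigl xpredT) => [|k]; last by rewrite inE.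
rewrite (bigD1_ord d) //= lift_perm_id /=.
rewrite [X in X + _](_ : _ = 0) ?add0n; last by lia.
apply: eq_bigr => k _; rewrite val_lift_perm /= /bump; lia.
Qed.

Lemma rank_mono m (s : 'S_m) a a' b : a <= a' -> rank s a b <= rank s a' b.
Proof.
move=> aa; apply: subset_leq_card; apply/subsetP=> k; rewrite !inE /=; lia.
Qed.

Lemma rank_max m (s : 'S_m) a b : m <= b -> rank s a b = minn a m.
Proof.
move=> mb; have := rank_upper s a b; suff -> : upper_in setT s a b = set0.
  by rewrite cards0 addn0.
by apply/setP=> k; rewrite !inE; have := ltn_ord (s k); lia.
Qed.

(** A largest value inserted further left takes up a column in more initial segments and adds
    nothing to rows below [n], so ranks drop. *)
Lemma bruhat_lift d p s t : d <= p -> bruhat t s ->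
  bruhat (lift_perm p ord_max t) (lift_perm d ord_max s).
Proof.
move=> dp /bruhatP ts; apply/bruhatP=> a b; case: (leqP b n) => bn; last first.
  by rewrite !rank_max.
rewrite !rank_lift //; apply: leq_trans (ts _ _) (rank_mono _ _ _).
by lia.
Qed.

Lemma sum_geq (m c : nat) : \sum_(k < m) (c <= k) = m - c.
Proof.
elim: m => [|m IH]; first by rewrite big_ord0.
by rewrite big_ord_recr /= IH; lia.
Qed.

Lemma inv_count_lift d s :
  inv_count (lift_perm d ord_max s) = inv_count s + (n - d).
Proof.
rewrite /inv_count (bigD1_ord d) //= addnC; congr (_ + _).
  apply: eq_bigr => k _; rewrite (bigD1_ord d) //= lift_perm_id val_lift_perm.
  rewrite [X in X + _](_ : _ = 0) ?add0n; last first.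
    by rewrite /=; have := ltn_ord (s k); lia.
  apply: eq_bigr => l _; rewrite val_lift_perm /= /bump; lia.
rewrite (bigD1_ord d) //= ltnn add0n -sum_geq; apply: eq_bigr => k _.
by rewrite val_lift_perm lift_perm_id /= /bump; have := ltn_ord (s k); lia.
Qed.

End Lift.

Lemma card_inversions n (s : 'S_n) : #|inversions s| = inv_count s.
Proof.
rewrite /inv_count pair_big /= -sum1_card big_mkcond /=.
by apply: eq_bigr => p _; rewrite inE; case: (_ && _).
Qed.

Lemma inv_countV n (s : 'S_n) : inv_count s^-1 = inv_count s.
Proof.
rewrite /inv_count exchange_big /= (reindex_inj (@perm_inj _ s)) /=.
apply: eq_bigr => i _; rewrite (reindex_inj (@perm_inj _ s)) /=.
by apply: eq_bigr => j _; rewrite !permK andbC.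
Qed.

(** * Prefix maxima *)

Section PrefixMax.
Variable n : nat.
Implicit Types s t : 'S_n.

Lemma prefix_max_geq s (k : 'I_n) i : k <= i -> s k <= prefix_max s i.
Proof. by move=> ki; rewrite /prefix_max (bigmax_sup k). Qed.

Lemma prefix_max_attained s i : i < n ->
  exists2 k : 'I_n, k <= i & s k = prefix_max s i :> nat.
Proof.
move=> i_n; have A0 : 0 < #|[pred k : 'I_n | k <= i]|.
  by apply/card_gt0P; exists (Ordinal i_n); rewrite inE /=.
have [k ki E] := eq_bigmax_cond (fun k => s k : nat) A0.
by exists k => //; rewrite /prefix_max -E; apply: eq_bigl => l.
Qed.

Lemma prefix_maxE s i m : (forall k : 'I_n, k <= i -> s k <= m) ->
  (exists2 k : 'I_n, k <= i & s k = m :> nat) -> prefix_max s i = m.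
Proof.
move=> le_m [k ki sk]; apply/eqP; rewrite eqn_leq -{2}sk prefix_max_geq // andbT.
exact/bigmax_leqP.
Qed.

Lemma rank_full s a b : a <= n -> (forall k : 'I_n, k < a -> s k < b) ->
  rank s a b = a.
Proof.
move=> an H; have := rank_upper s a b; suff -> : upper_in setT s a b = set0.
  rewrite cards0; lia.
by apply/setP=> k; rewrite !inE; apply/negbTE; have := H k; lia.
Qed.

Lemma rank_leq s a b : rank s a b <= minn a b.
Proof. have := rank_upper s a b; have := rank_lower s a b; lia. Qed.

Lemma rank_fullP s a b : a <= n -> a <= rank s a b ->
  forall k : 'I_n, k < a -> s k < b.
Proof.
move=> an r k ka; have := rank_upper s a b; case: (ltnP (s k) b) => // bs.
have : 0 < #|upper_in setT s a b|.
  by apply/card_gt0P; exists k; rewrite !inE ka bs.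
lia.
Qed.

Lemma prefix_max_stair s : stair n (prefix_max s).
Proof.
split=> [i i_n|i j ij _]; last first.
  apply/bigmax_leqP=> k ki; exact: prefix_max_geq (leq_trans ki ij).
have [k ki sk] := prefix_max_attained s i_n; rewrite -{2}sk ltn_ord andbT.
rewrite leqNgt; apply/negP=> lt_i.
have := rank_leq s i.+1 i; rewrite rank_full //; first lia.
by move=> l; rewrite ltnS => /(prefix_max_geq s); lia.
Qed.

(** The point at [k] keeps the rows of the square [[0, c] x [0, c]] from being filled; then its
    equally many columns are not filled either. *)
Lemma crossing s (k : 'I_n) c : c < k -> s k <= c ->
  exists2 l : 'I_n, l <= c & c < s l.
Proof.
move=> ck sc; have := rank_upper s c.+1 c.+1; have := rank_lower s c.+1 c.+1.
have : 0 < #|lower_in setT s c.+1 c.+1|.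
  by apply/card_gt0P; exists k; rewrite !inE ck ltnS sc.
move=> lo; have : 0 < #|upper_in setT s c.+1 c.+1| -> 
    exists2 l : 'I_n, l <= c & c < s l.
  by case/card_gt0P=> l; rewrite !inE /= ltnS => /andP[lc cs]; exists l.
by move=> ex h h'; apply: ex; lia.
Qed.

End PrefixMax.

Lemma fitsV n f g (s : 'S_n) : fits f g s -> fits g f s^-1.
Proof. by move=> F k; have := F (s^-1%g k); rewrite permKV => -[]. Qed.

Lemma fits_prefix_max n (s : 'S_n) : fits (prefix_max s) (prefix_max s^-1) s.
Proof.
move=> k; split; first exact: prefix_max_geq.
by rewrite -{1}[k](permK s) prefix_max_geq.
Qed.

(** Since [f] is monotone, the rank of [s] at [k.+1], [(f k).+1] is the full [k.+1], and the ranks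
    of [t] are at least as large. *)
Lemma fits_lowerl n f g (s t : 'S_n) : stair n f ->
  bruhat t s -> fits f g s -> forall k : 'I_n, t k <= f k.
Proof.
move=> [_ fM] /bruhatP ts F k; rewrite -ltnS.
apply: (@rank_fullP _ t k.+1) => //; apply: leq_trans (ts _ _).
rewrite rank_full // => l lk; rewrite ltnS; have [+ _] := F l => /leq_trans; apply.
exact: fM.
Qed.

Lemma fits_lower n f g (s t : 'S_n) : stair n f -> stair n g ->
  bruhat t s -> fits f g s -> fits f g t.
Proof.
move=> sf sg ts F k; split; first exact: fits_lowerl ts F k.
have := fits_lowerl sg (bruhatV ts) (fitsV F) (t k); by rewrite permK.
Qed.

Section PrefixMaxLift.
Variables (n : nat) (d : 'I_n.+1) (s : 'S_n).
Let t := lift_perm d ord_max s.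

Lemma prefix_max_lift_lt i : i < d -> prefix_max t i = prefix_max s i.
Proof.
move=> id; have i_n : i < n by have := ltn_ord d; lia.
apply: prefix_maxE => [k ki|].
  case: (unliftP d k) ki => [l ->|->]; last by lia.
  rewrite val_lift_perm /= /bump => ki; apply: prefix_max_geq; lia.
have [k ki sk] := prefix_max_attained s i_n; exists (lift d k).
  by rewrite /= /bump; lia.
by rewrite val_lift_perm.
Qed.

Lemma prefix_max_lift_geq i : d <= i -> prefix_max t i = n.
Proof.
move=> di; apply: prefix_maxE => [k _|]; first by rewrite -ltnS ltn_ord.
by exists d; rewrite // lift_perm_id.
Qed.

Lemma prefix_max_liftV i : i < n ->
  prefix_max t^-1 i = bump d (prefix_max s^-1 i).
Proof.
move=> i_n; apply: prefix_maxE => [k ki|].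
  case: (unliftP ord_max k) ki => [l ->|->] /=; last by lia.
  rewrite -[X in X <= _ -> _]/(nat_of_ord (lift ord_max l)) val_lift_max.
  move=> li; rewrite val_lift_permV leq_bump2; exact: prefix_max_geq.
have [k ki sk] := prefix_max_attained s^-1 i_n; exists (lift ord_max k).
  by rewrite val_lift_max.
by rewrite val_lift_permV sk.
Qed.

End PrefixMaxLift.

(* Both sides are compared after deleting the largest value, which lowers the
   weight by at least as much as the inversion count. *)
Lemma inv_count_leq_weight n (s : 'S_n) :
  inv_count s <= weight n (prefix_max s) (prefix_max s^-1) /\
  (inv_count s = weight n (prefix_max s) (prefix_max s^-1) ->
   good n (prefix_max s) (prefix_max s^-1)).
Proof.
elim: n s => [|n IH] s.
  by split=> [|_ i j]; rewrite /inv_count ?big_ord0.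
have [d sd] : exists d, s d = ord_max by exists ((s^-1)%g ord_max); rewrite permKV.
have [s' ->] := exists_lift_perm sd => {s sd}.
have [le' good'] := IH s'.
set m := prefix_max s' in le' good'; set m' := prefix_max s'^-1 in le' good'.
set M := prefix_max _; set M' := prefix_max _.
have [m_id m_mono] := prefix_max_stair s'.
have [m'_id m'_mono] := prefix_max_stair s'^-1.
have ML i : i < d -> M i = m i by exact: prefix_max_lift_lt.
have MR i : d <= i -> M i = n by exact: prefix_max_lift_geq.
have M'E i : i < n -> M' i = bump d (m' i) by exact: prefix_max_liftV.
(* [e] is the weight term after the insertion; [e'] is the old term plus an indicator that sums to
   the number [n - d] of new inversions. *)
pose e (i : nat) := minn (M i) (M' i) - i.
pose e' (i : nat) := minn (m i) (m' i) - i + (d <= i).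
have le_e (i : 'I_n) : e' i <= e i.
  have i_n := ltn_ord i; have := m_id i i_n; have := m'_id i i_n.
  rewrite /e /e' M'E // /bump; case: (ltnP i d) => id; first by rewrite ML //; lia.
  rewrite MR // -/m -/m'; lia.
have wE : weight n.+1 M M' = \sum_(i < n) e i.
  rewrite /weight big_ord_recr /= MR; last by rewrite -ltnS.
  by rewrite [X in _ + X](_ : _ = 0) ?addn0 //; lia.
have w'E : \sum_(i < n) e' i = weight n m m' + (n - d).
  by rewrite /e' big_split /= sum_geq.
have le_sum : \sum_(i < n) e' i <= \sum_(i < n) e i by apply: leq_sum.
rewrite inv_count_lift wE; split; first by lia.
move=> E; have eE (i : 'I_n) : e' i = e i.
  have : \sum_(i < n) e' i == \sum_(i < n) e i by lia.
  rewrite eqn_leq leq_sum // => H; apply/eqP; rewrite eqn_leq le_e /=.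
  move: H; rewrite /= leqNgt; apply: contraNT; rewrite -ltnNge => lt_i.
  rewrite (bigD1 i) //= [X in _ < X](bigD1 i) //= -addSn leq_add //.
  exact: leq_sum.
have {}good' : good n m m' by apply: good'; lia.
move=> i j ij jn jM jM'.
have [di|id] := leqP d i; first by left; rewrite !MR //; lia.
have i_n : i < n by have := ltn_ord d; lia.
rewrite ML // in jM *; rewrite M'E // in jM' *.
have mi := m_id i i_n; have m'i := m'_id i i_n; rewrite -/m -/m' in mi m'i.
have {}jn : j < n by lia.
rewrite M'E //; have [jd|dj] := ltnP j d.
  rewrite ML //; case: (good' i j) => //; first by move: jM'; rewrite /bump; lia.
    by left.
  by move=> ->; right.
right; congr bump.
(* The terms at [i] and [j] give [m i <= m' i] and [m' j <= m j], so even the alternative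
   [m i = m j] squeezes [m' i] and [m' j] together. *)
have := eE (Ordinal i_n); have := eE (Ordinal jn); rewrite /e /e' /=.
rewrite (ML i) // (MR j) // !M'E // /bump.
have := m_id j jn; have := m'_id j jn; have := m'_mono i j ij jn; have := m_mono i j ij jn.
rewrite -/m -/m'; move: jM'; rewrite /bump => jM' h1 h2 h3 h4 h5 h6.
by case: (good' i j ij jn) => //; lia.
Qed.

(** * The Bruhat maximum of a good region *)

Definition avoids3412 (n : nat) (s : 'S_n) : Prop :=
  forall p p' q q' : 'I_n, p < p' -> p' < q -> q < q' ->
    s q < s q' -> s q' < s p -> s p < s p' -> False.

(** One induction yields all clauses. The fourth identifies a smooth permutation with the maximum of
    its region; the last serves the converse direction. *)
Definition is_top (n : nat) (f g : nat -> nat) (s : 'S_n) : Prop :=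
  [/\ fits f g s,
      forall t : 'S_n, fits f g t -> bruhat t s,
      inv_count s = weight n f g,
      forall t : 'S_n, fits f g t -> inv_count t <= weight n f g /\
        (inv_count t = weight n f g -> t = s) &
      avoids3412 s].

Lemma weightC n f g : weight n f g = weight n g f.
Proof. by apply: eq_bigr => i _; rewrite minnC. Qed.

Lemma goodC n f g : good n f g -> good n g f.
Proof. by move=> G i j ij jn jg jf; case: (G i j ij jn jf jg); auto. Qed.

Lemma avoids3412V n (s : 'S_n) : avoids3412 s -> avoids3412 s^-1.
Proof.
move=> A p p' q q' pp' p'q qq' h1 h2 h3.
by apply: (A (s^-1 q) (s^-1 q') (s^-1 p) (s^-1 p'))%g => //; rewrite !permKV.
Qed.

Lemma is_topV n f g (s : 'S_n) : is_top f g s -> is_top g f s^-1.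
Proof.
case=> F M W U A; split.
- exact: fitsV.
- by move=> t /fitsV/M/bruhatV; rewrite invgK.
- by rewrite inv_countV weightC.
- move=> t /fitsV/U; rewrite inv_countV weightC => -[le_t eq_t]; split=> //.
  by move/eq_t=> <-; rewrite invgK.
- exact: avoids3412V.
Qed.

Section Step.
Variables (n : nat) (f g : nat -> nat) (d : nat).
Hypotheses (sf : stair n.+1 f) (sg : stair n.+1 g) (G : good n.+1 f g).
Hypotheses (dn : d <= n) (fd : f d = n) (gd : g d = n).
Hypothesis f_lt : forall i, i < d -> f i < n.

Lemma top_after i : d <= i -> i <= n -> f i = n /\ g i = n.
Proof.
move=> di i_n; have [f1 f2] := sf; have [g1 g2] := sg.
have := f1 i; have := g1 i; have := f2 d i; have := g2 d i; lia.
Qed.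

Lemma top_f i : d <= i -> i <= n -> f i = n.
Proof. by move=> di /(top_after di)[]. Qed.

Lemma top_g i : d <= i -> i <= n -> g i = n.
Proof. by move=> di /(top_after di)[]. Qed.

(** Induction along [j], [f j], [f (f j)], ... towards [d]. As [f] still grows there, goodness
    forces [g j = g (f j)], or [g j = g d] once [f j] reaches [d]. *)
Lemma connected_top j : j < d -> d <= g j ->
  (forall m, j <= m < d -> m < f m) -> g j = n.
Proof.
have [m] := ubnP (d - j); elim: m j => // m IH j jm jd dg up.
have [f1 f2] := sf; have [g1 g2] := sg.
have jf : j < f j by apply: up; lia.
case: (leqP d (f j)) => dfj.
  case: (G (ltnW jd) _ dfj dg) => //; last by rewrite gd.
  by rewrite fd => E; have := f_lt jd; lia.
have gm : g (f j) = n.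
  apply: IH => //; first by lia.
    by have := g2 j (f j); lia.
  by move=> k kk; apply: up; lia.
case: (@G j (f j)) => //; [lia|lia|lia| |by rewrite gm].
by have := up (f j); lia.
Qed.

(** If [t k < d <= k], then [crossing] yields a point above the diagonal at each [m] from [t k] up
    to [d], as [connected_top] requires. *)
Lemma fits_top_rows (t : 'S_n.+1) (k : 'I_n.+1) : fits f g t -> d <= k ->
  g (t k) = n.
Proof.
move=> F dk; have [_ kg] := F k; have tn := ltn_ord (t k).
case: (leqP d (t k)) => dt; first by apply: top_g => //; lia.
apply: connected_top => //; first by lia.
move=> m mm; have [l lm ml] : exists2 l : 'I_n.+1, l <= m & m < t l.
  by apply: (@crossing _ t k); lia.
have [tf _] := F l; have [f1 f2] := sf; have := f2 l m; lia.
Qed.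

(** The region left when column [d] and row [n] are deleted; a bound [g j] that reaches [d] shifts
    down by one. *)
Let f' i := if i < d then f i else n.-1.
Let g' j := g j - (d <= g j).

Lemma stair_f' : stair n f'.
Proof.
have [f1 f2] := sf; split=> [i i_n|i j ij jn]; rewrite /f'.
  by case: ltnP => id; [have := f_lt id; have := f1 i; lia | lia].
case: (ltnP i d) => id; case: (ltnP j d) => jd; try lia; first by apply: f2; lia.
by have := f_lt id; lia.
Qed.

Lemma stair_g' : stair n g'.
Proof.
have [g1 g2] := sg; split=> [i i_n|i j ij jn]; rewrite /g'.
  case: (ltnP i d) => id; first by have := g1 i; lia.
  by rewrite top_g; lia.
by have := g2 i j; lia.
Qed.

Lemma good' : good n f' g'.
Proof.
have [f1 f2] := sf; have [g1 g2] := sg.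
move=> i j ij jn; rewrite /f' /g'; case: (ltnP i d) => id; last first.
  by case: (ltnP j d) => jd; [lia | left].
case: (ltnP j d) => jd jf jg.
  case: (@G i j) => //; [lia | lia | by left | by move=> ->; right].
right; have [] := @G i d; [lia | lia | lia | lia | | ].
  by rewrite fd; have := f_lt id; lia.
by rewrite gd => ->; rewrite top_g //; lia.
Qed.

Let D : 'I_n.+1 := Ordinal (dn : d < n.+1).

Lemma fits_lift (s : 'S_n) : fits f' g' s -> fits f g (lift_perm D ord_max s).
Proof.
have [f1 f2] := sf; have [g1 g2] := sg.
move=> F k; case: (lift_or D k) => [[l ->]|->]; last first.
  by rewrite lift_perm_id /= fd top_g.
rewrite val_lift_perm /=; have [] := F l; rewrite /f' /g'.
have ln := ltn_ord l; have sn := ltn_ord (s l).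
case: (ltnP l d) => ld h1 h2; split; rewrite /bump /=; [|lia| |].
- by rewrite [d <= l]leqNgt ld.
- by rewrite top_f; lia.
- have [d0|] := posnP d; last by lia.
  by rewrite top_g; lia.
Qed.

(** Deleting a column [p >= d] in place of [d] does no harm: by [fits_top_rows] the points in
    columns from [d] on lie in rows where [g] is [n]. *)
Lemma fits_delete (p : 'I_n.+1) (t : 'S_n) :
  fits f g (lift_perm p ord_max t) -> d <= p /\ fits f' g' t.
Proof.
move=> F; have dp : d <= p.
  by rewrite leqNgt; apply/negP=> /f_lt; have [] := F p; rewrite lift_perm_id /=; lia.
split=> // l; have := F (lift p l); have := @fits_top_rows _ (lift p l) F.
rewrite !val_lift_perm /= /f' /g' /bump => top [h1 h2].
have ln := ltn_ord l; have tn := ltn_ord (t l).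
case: (ltnP l d) => ld; split; [|lia|lia|].
  by move: h1; rewrite [p <= l]leqNgt (leq_trans ld dp).
by rewrite top; lia.
Qed.

(** Columns from [d] to [n - 1] lose one each and column [n] has term 0. Earlier columns lose
    nothing, since goodness at [i] and [d] excludes [d <= g i <= f i]. *)
Lemma weight_step : weight n.+1 f g = weight n f' g' + (n - d).
Proof.
have [f1 f2] := sf; have [g1 g2] := sg.
rewrite /weight big_ord_recr /= -(sum_geq n d) -big_split /=.
rewrite top_f // top_g //.
rewrite minnn subnn addn0; apply: eq_bigr => i _; have i_n := ltn_ord i.
rewrite /f' /g'; case: (ltnP i d) => id; last first.
  by rewrite top_f ?top_g; lia.
case: (leqP d (g i)) => dg; last by lia.
case: (ltnP (f i) (g i)) => fg; first by lia.
case: (@G i d); [lia | lia | lia | lia | | ]; have := f_lt id; lia.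
Qed.

Lemma rank_tperm m (s : 'S_m) (q q' : 'I_m) b : q < q' ->
  rank (tperm q q' * s)%g q b = rank s q b.
Proof.
move=> qq'; congr #|pred_of_set _|; apply/setP=> k; rewrite !inE /=.
case: (ltnP k q) => //= kq; rewrite permM tpermD //.
  by rewrite -val_eqE /=; lia.
by rewrite -val_eqE /=; lia.
Qed.

Lemma not_bruhat_tperm m (s : 'S_m) (q q' : 'I_m) : q < q' -> s q < s q' ->
  ~ bruhat (tperm q q' * s)%g s.
Proof.
move=> qq' ss' /bruhatP/(_ q.+1 (s q).+1).
by rewrite -!rank_step rank_tperm // permM tpermL; lia.
Qed.

Lemma is_top_lift (s : 'S_n) : is_top f' g' s ->
  is_top f g (lift_perm D ord_max s).
Proof.
case=> F M W U A; set S := lift_perm D ord_max s.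
have FS : fits f g S by exact: fits_lift.
have MS t : fits f g t -> bruhat t S.
  move=> Ft; have [p tp] : exists p, t p = ord_max.
    by exists ((t^-1)%g ord_max); rewrite permKV.
  have [t' E] := exists_lift_perm tp; subst t.
  by have [dp /M] := fits_delete Ft; apply: bruhat_lift.
split=> //.
- by rewrite inv_count_lift W weight_step.
- move=> t Ft; have [p tp] : exists p, t p = ord_max.
    by exists ((t^-1)%g ord_max); rewrite permKV.
  have [t' E] := exists_lift_perm tp; subst t.
  have [dp /U [le_t eq_t]] := fits_delete Ft.
  rewrite inv_count_lift weight_step; have pn := ltn_ord p; split; first by lia.
  move=> E; have -> : t' = s by apply: eq_t; lia.
  by congr lift_perm; apply: val_inj => /=; lia.
- move=> p p' q q' pp' p'q qq' h1 h2 h3.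
  have SD : S D = n :> nat by rewrite lift_perm_id.
  have Sn k : S k <= n by rewrite -ltnS.
  have SDn k : S D < S k -> False by rewrite SD ltnNge Sn.
  case: (lift_or D p) => [[k E]|E]; subst p; last exact: SDn h3.
  case: (lift_or D q) => [[l E]|E]; subst q; last exact: SDn h1.
  case: (lift_or D q') => [[l' E]|E]; subst q'; last exact: SDn h2.
  case: (lift_or D p') => [[k' E]|E]; subst p'.
    move: h1 h2 h3 pp' p'q qq'; rewrite !val_lift_perm /= !(ltnNge (bump _ _)) !leq_bump2 -!ltnNge => *.
    exact: (A k k' l l').
  (* Here [p'] is the column of the largest value, so [q] and [q'] lie beyond [d]. Exchanging their
     values stays in the region but gives a permutation that is not below [S]. *)
  apply: (not_bruhat_tperm qq' h1); apply: MS => r.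
  rewrite permM; have [f1 f2] := sf.
  have dl := p'q; have dl' := ltn_trans p'q qq'; rewrite /= in dl dl'.
  have ft (i : 'I_n.+1) : d < i -> f i = n.
    by move=> di; apply: top_f; [exact: ltnW | rewrite -ltnS].
  case: tpermP => [->|->|_ _]; last exact: FS.
    rewrite ft // (@fits_top_rows _ (lift D l') FS (ltnW dl')); split; first exact: Sn.
    by rewrite -ltnS.
  rewrite ft // (@fits_top_rows _ (lift D l) FS (ltnW dl)); split; first exact: Sn.
  by rewrite -ltnS.
Qed.

End Step.

Theorem exists_top n f g : stair n f -> stair n g -> good n f g ->
  exists s : 'S_n, is_top f g s.
Proof.
elim: n f g => [|n IH] f g sf sg G.
  exists 1%g; split=> [[]|t _|||[]] //; first by rewrite (_ : t = 1%g) ?bruhat_refl //; apply/permP=> -[].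
    by rewrite /inv_count /weight !big_ord0.
  by move=> t _; rewrite /inv_count /weight !big_ord0; split=> // _; apply/permP=> -[].
have ex h : stair n.+1 h -> exists d, [/\ d <= n, h d = n & forall i, i < d -> h i < n].
  case=> h1 h2; have hn : exists d, h d == n by exists n; have := h1 n; lia.
  case: (ex_minnP hn) => d /eqP hd dmin; exists d.
  have dn : d <= n by apply: dmin; have := h1 n; lia.
  split=> // i id; have := dmin i; have := h1 i; lia.
(* [d] is the first column where [f] reaches [n]; after passing to inverses if necessary, [g]
   reaches [n] no later. *)
wlog : f g sf sg G / exists d, [/\ d <= n, f d = n, g d = n & forall i, i < d -> f i < n].
  move=> W; have [d [dn fd d_min]] := ex f sf; have [e [en ge e_min]] := ex g sg.
  have [f1 f2] := sf; have [g1 g2] := sg.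
  case: (leqP e d) => ed.
    by apply: W => //; exists d; split=> //; have := g2 e d; have := g1 d; lia.
  have [] := W g f sg sf (goodC G); last by move=> s /is_topV; exists s^-1%g.
  by exists e; split=> //; have := f2 d e; have := f1 e; lia.
case=> d [dn fd gd d_min].
have [s tops] : exists s : 'S_n, is_top (fun i => if i < d then f i else n.-1)
    (fun j => g j - (d <= g j)) s.
  by apply: IH; [exact: stair_f' | exact: (@stair_g' n f) | exact: good'].
eexists; exact: is_top_lift tops.
Qed.

(** * Smoothness and transpositions *)

Section Smooth.
Variable n : nat.
Implicit Types (s t : 'S_n) (f g : nat -> nat).

Lemma rank_monor s a b b' : b <= b' -> rank s a b <= rank s a b'.
Proof. by move=> bb; rewrite -!(rankV s); apply: rank_mono. Qed.

(** The identity has rank [minn a b], so this allows a deficit of one. *)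
Definition near_id t := forall a b, a <= n -> b <= n -> minn a b <= (rank t a b).+1.

(** The rank of [s] can exceed that of [t] only where it is [minn a b]. For [a <= b] the first [a]
    values of [s] are then below [b], and so are those of [t], being bounded by the prefix maxima of
    [s]. *)
Lemma near_bruhat s t : near_id t ->
  fits (prefix_max s) (prefix_max s^-1) t -> bruhat t s.
Proof.
wlog suff W : s t / near_id t -> fits (prefix_max s) (prefix_max s^-1) t ->
    forall a b, a <= b -> b <= n -> rank s a b <= rank t a b.
  move=> N F; apply/bruhatP=> a b; rewrite (rank_minn s) (rank_minn t).
  have [ab|/ltnW ba] := leqP (minn a n) (minn b n); first by apply: W => //; lia.
  rewrite -(rankV s) -(rankV t).
  apply: W; [|by rewrite invgK; exact: fitsV|by []|by lia].
  by move=> c e cn en; rewrite rankV minnC; exact: N.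
move=> N F a b ab bn; have an : a <= n by lia.
have := N a b an bn; have := rank_leq s a b; have := rank_leq t a b.
case: (leqP a (rank s a b)) => [full _ _ _|]; last by lia.
rewrite leq_eqVlt; apply/orP; left; apply/eqP.
have H := rank_fullP an full; rewrite (rank_full an H) (rank_full an) // => k ka.
have [tk _] := F k; apply: leq_ltn_trans tk _.
have [l lk <-] := prefix_max_attained s (ltn_ord k).
by apply: H; apply: leq_ltn_trans lk ka.
Qed.

Lemma near_id_one_descent t :
  (forall k l : 'I_n, t k < k -> t l < l -> k = l) -> near_id t.
Proof.
move=> one; have lower a b : b <= a -> #|lower_in setT t a b| <= 1.
  move=> ba; rewrite leqNgt; apply/negP=> /card_gt1P[k [l []]].
  rewrite !inE /= => /andP[ak kb] /andP[al lb]; rewrite (one k l) ?eqxx //; lia.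
move=> a b an bn; case: (leqP b a) => ab.
  by have := rank_lower t a b; have := lower a b ab; lia.
have := rank_lower t a a; have := lower a a (leqnn a).
by have := @rank_monor t a a b (ltnW ab); lia.
Qed.

Lemma near_id_tperm (i j : 'I_n) : i < j -> near_id (tperm i j).
Proof.
move=> ij; apply: near_id_one_descent => k l.
by do 2 (case: tpermP => [->|->|_ _]); rewrite ?ltnn //; lia.
Qed.

Lemma fits_tperm f g (i j : 'I_n) : stair n f -> stair n g -> i < j ->
  fits f g (tperm i j) <-> j <= f i /\ j <= g i.
Proof.
move=> [f1 f2] [g1 g2] ij; split=> [F|[jf jg] k].
  by have := F i; have := F j; rewrite tpermL tpermR; case=> _ ? [].
have := f1 k (ltn_ord k); have := g1 k (ltn_ord k).
have := f2 i j; have := g2 i j; have := ltn_ord j.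
by case: tpermP => [->|->|_ _]; lia.
Qed.

Lemma tperm_inj_lt (i j k l : 'I_n) : i < j -> k < l ->
  tperm i j = tperm k l -> (i, j) = (k, l).
Proof.
move=> ij kl E; have := tpermL i j; have := tpermR i j; rewrite E.
do 2 (case: tpermP => [?|?|? ?]); subst => //; move=> *; subst => //; lia.
Qed.

Lemma sum_between (i h m : nat) : i <= h -> h < m ->
  \sum_(k < m) ((i < k) && (k <= h)) = h - i.
Proof.
move=> ih hm; have := sum_geq m i.+1; have := sum_geq m h.+1.
suff -> : \sum_(k < m) (i < k) =
   \sum_(k < m) ((i < k) && (k <= h)) + \sum_(k < m) (h < k) by lia.
by rewrite -big_split /=; apply: eq_bigr => k _; lia.
Qed.

(** For [i < j] the transposition fits iff [j <= minn (f i) (g i)], which accounts for the term of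
    [i] in [weight]. The staircases are arbitrary because the region of an [is_top] need not come
    from prefix maxima. *)
Lemma card_transpositions f g (Q : pred 'S_n) : stair n f -> stair n g ->
  (forall i j : 'I_n, i < j -> Q (tperm i j) <-> fits f g (tperm i j)) ->
  #|[set T in transpositions n | Q T]| = weight n f g.
Proof.
move=> sf sg QE.
have Qb (i j : 'I_n) : i < j -> Q (tperm i j) = (j <= minn (f i) (g i)).
  move=> ij; rewrite leq_min; apply/idP/andP.
    by move/QE => /(_ ij); rewrite fits_tperm.
  by move=> H; apply/QE => //; apply/fits_tperm.
pose A := [set p : 'I_n * 'I_n | (p.1 < p.2) && (p.2 <= minn (f p.1) (g p.1))].
have -> : [set T in transpositions n | Q T] = [set tperm p.1 p.2 | p in A].
  apply/setP=> T; rewrite inE; apply/andP/imsetP.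
    case=> /imsetP[[i j]]; rewrite inE /= => ij -> QT.
    have [lt_ij|lt_ji|/val_inj E] := ltngtP i j; last by rewrite E eqxx in ij.
      by exists (i, j); rewrite // inE /= lt_ij -Qb.
    by exists (j, i); rewrite /= 1?tpermC // inE /= lt_ji -Qb // tpermC.
  case=> [[i j]]; rewrite inE /= => /andP[ij jh] ->; split; last by rewrite Qb.
  by apply/imsetP; exists (i, j); rewrite // inE /= -val_eqE /=; lia.
rewrite card_in_imset; last first.
  move=> [i j] [k l]; rewrite !inE /= => /andP[ij _] /andP[kl _].
  exact: tperm_inj_lt.
rewrite /weight -sum1_card big_mkcond /=.
rewrite (eq_bigr (fun p : 'I_n * 'I_n =>
  nat_of_bool ((p.1 < p.2) && (p.2 <= minn (f p.1) (g p.1))))); last first.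
  by move=> p _; rewrite inE; case: (_ && _).
rewrite -(pair_bigA _ (fun i j : 'I_n => nat_of_bool ((i < j) && (j <= minn (f i) (g i))))) /=.
apply: eq_bigr => i _; have [f1 _] := sf; have [g1 _] := sg.
by apply: sum_between; have := f1 i; have := g1 i; have := ltn_ord i; lia.
Qed.

Lemma smoothE s :
  smooth s = (inv_count s == weight n (prefix_max s) (prefix_max s^-1)).
Proof.
rewrite /smooth card_inversions.
rewrite (@card_transpositions (prefix_max s) (prefix_max s^-1)) //;
  try exact: prefix_max_stair.
move=> i j ij; split=> [T|]; last exact/near_bruhat/near_id_tperm.
by apply: fits_lower T _; try exact: prefix_max_stair; exact: fits_prefix_max.
Qed.

Lemma is_top_smooth f g s : stair n f -> stair n g -> is_top f g s -> smooth s.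
Proof.
move=> sf sg [F M W _ _]; rewrite /smooth card_inversions W.
rewrite (@card_transpositions f g) // => i j ij; split; last exact: M.
by move=> T; apply: fits_lower T F.
Qed.

Lemma smooth_good s : smooth s -> good n (prefix_max s) (prefix_max s^-1).
Proof. by rewrite smoothE => /eqP; apply: (inv_count_leq_weight s).2. Qed.

Lemma smooth_is_top s : smooth s -> is_top (prefix_max s) (prefix_max s^-1) s.
Proof.
move=> sm; have [u top] := exists_top (prefix_max_stair s)
  (prefix_max_stair s^-1) (smooth_good sm).
have [F M W U A] := top; suff E : s = u by rewrite -E in top.
by apply: (U _ (fits_prefix_max s)).2; apply/eqP; rewrite -smoothE.
Qed.

End Smooth.

(** * Restriction to a block *)

Section Restriction.
Variables (n : nat) (X : {set 'I_n}).
Implicit Types (s t : 'S_n) (f g : nat -> nat).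

Lemma eta_leq (a b : 'I_#|X|) : (eta a <= eta b) = (a <= b).
Proof. by rewrite leqNgt eta_mono -leqNgt. Qed.

Lemma eta_inj : injective (@eta n X).
Proof. exact: (eta_bij X).1. Qed.

Lemma eta_onto x : x \in X -> exists a : 'I_#|X|, x = eta a.
Proof. by move=> /((eta_bij X).2 x) [a <-]; exists a. Qed.

Lemma card_eta (Q : pred 'I_n) :
  #|[set x in X | Q x]| = #|[set a : 'I_#|X| | Q (eta a)]|.
Proof.
rewrite -[RHS](card_imset _ eta_inj); congr #|pred_of_set _|.
apply/setP=> x; rewrite inE; apply/andP/imsetP.
  by case=> /eta_onto[a ->] Qa; exists a; rewrite // inE.
by case=> a; rewrite inE => Qa ->; rewrite eta_in.
Qed.

Lemma below_eta (k : 'I_#|X|) : below X (eta k) = k.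
Proof.
rewrite /below card_eta -[RHS](minn_idPl (ltnW (ltn_ord k))) -below_setT /below.
by congr #|pred_of_set _|; apply/setP=> a; rewrite !inE eta_mono.
Qed.

Lemma below_mono a b : a <= b -> below X a <= below X b.
Proof.
by move=> ab; apply: subset_leq_card; apply/subsetP=> x; rewrite !inE; lia.
Qed.

Lemma eta_lt_below (k : 'I_#|X|) a : (eta k < a) = (k < below X a).
Proof.
apply/idP/idP=> [ka|]; last first.
  by rewrite !ltnNge; apply: contra => /below_mono; rewrite below_eta.
by apply: leq_trans (below_mono ka); rewrite -below_ordE below_eta eta_in addn1.
Qed.

Lemma below_onto a : exists a', minn a #|X| = below X a'.
Proof.
case: (ltnP a #|X|) => aX; last first.
  exists n; rewrite /below; apply: eq_card => x.
  by rewrite !inE ltn_ord andbT.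
by exists (eta (Ordinal aX)); rewrite below_eta.
Qed.

Lemma rank_coord t a b : t @: X = X ->
  rank (coord X t) (below X a) (below X b) = rank_in X t a b.
Proof.
move=> tX; rewrite /rank {2}/rank_in card_eta; apply: eq_card => k.
by rewrite !inE -!eta_lt_below coordE.
Qed.

(** Up to [#|X|], every bound on coordinates is a value of [below X], so coordinates can be compared
    by counting inside [X]. *)
Lemma bruhat_coord t s : t @: X = X -> s @: X = X ->
  reflect (forall a b, rank_in X s a b <= rank_in X t a b)
          (bruhat (coord X t) (coord X s)).
Proof.
move=> tX sX; apply: (iffP (bruhatP _ _)) => H a b.
  by rewrite -!rank_coord.
rewrite (rank_minn (coord X s)) (rank_minn (coord X t)).
have [a' ->] := below_onto a; have [b' ->] := below_onto b.
by rewrite !rank_coord.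
Qed.

Lemma stable_setC t : t @: X = X -> t @: (~: X) = ~: X.
Proof.
move=> tX; apply/setP=> x; rewrite -[x](permKV t) (mem_imset _ _ (@perm_inj _ t)).
by rewrite !inE -{2}tX (mem_imset _ _ (@perm_inj _ t)).
Qed.

(* The staircase [f] read in the coordinates of [X]; going through all [a' <= a]
   keeps it monotone at arguments outside the range of the coordinates. *)
Definition restrict f (a : nat) : nat :=
  \max_(b < #|X| | [exists a' : 'I_#|X|, (a' <= a) && (eta b <= f (eta a'))]) b.

Lemma leq_restrict f (a b : 'I_#|X|) : stair n f ->
  (b <= restrict f a) = (eta b <= f (eta a)).
Proof.
move=> [f1 f2]; apply/idP/idP=> [|ba]; last first.
  by apply: (bigmax_sup b) => //; apply/existsP; exists a; rewrite leqnn.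
have A0 : 0 < #|[pred b : 'I_#|X| |
     [exists a' : 'I_#|X|, (a' <= a) && (eta b <= f (eta a'))]]|.
  apply/card_gt0P; exists a; rewrite inE; apply/existsP; exists a; rewrite leqnn /=.
  by have := f1 (eta a) (ltn_ord _); lia.
have [c /existsP[a' /andP[a'a ca]] E] := eq_bigmax_cond (fun c : 'I_#|X| => c : nat) A0.
rewrite /restrict; move: E; rewrite (eq_bigl _ _ (fun _ => erefl)) => -> bc.
apply: leq_trans (leq_trans ca _); first by rewrite eta_leq.
by apply: f2; rewrite ?eta_leq.
Qed.

Lemma restrict_stair f : stair n f -> stair #|X| (restrict f).
Proof.
move=> sf; have [f1 f2] := sf; split=> [i iX|i j ij jX]; last first.
  apply/bigmax_leqP=> b /existsP[a /andP[ai ba]]; apply: (bigmax_sup b) => //.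
  by apply/existsP; exists a; rewrite (leq_trans ai).
rewrite -[i]/(nat_of_ord (Ordinal iX)) leq_restrict //.
have := f1 (eta (Ordinal iX)) (ltn_ord _) => /andP[-> _] /=.
have X0 : 0 < #|X| by apply: leq_ltn_trans iX.
by rewrite -[X in _ < X](prednK X0) ltnS; apply/bigmax_leqP=> b _; rewrite -ltnS prednK.
Qed.

Lemma restrict_eq f (a b : 'I_#|X|) : stair n f -> f (eta a) = f (eta b) ->
  restrict f a = restrict f b.
Proof.
move=> sf E; have [f1 f2] := restrict_stair sf.
have fa := f1 a (ltn_ord a); have fb := f1 b (ltn_ord b).
have [_ fa2] := andP fa; have [_ fb2] := andP fb.
have := @leq_restrict f a (Ordinal fa2) sf; have := @leq_restrict f b (Ordinal fa2) sf.
have := @leq_restrict f a (Ordinal fb2) sf; have := @leq_restrict f b (Ordinal fb2) sf.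
rewrite /= E; lia.
Qed.

Lemma restrict_good f g : stair n f -> stair n g -> good n f g ->
  good #|X| (restrict f) (restrict g).
Proof.
move=> sf sg G i j ij jX; have iX := leq_ltn_trans ij jX.
rewrite -[i]/(nat_of_ord (Ordinal iX)) -[j]/(nat_of_ord (Ordinal jX)).
rewrite !leq_restrict // => jf jg.
case: (G _ _ _ _ jf jg) => //; first by rewrite eta_leq.
  by move=> /(restrict_eq sf); left.
by move=> /(restrict_eq sg); right.
Qed.

(** This locality lets the region condition be checked block by block. *)
Lemma fits_coordP f g t : stair n f -> stair n g -> t @: X = X ->
  fits (restrict f) (restrict g) (coord X t) <->
  (forall x, x \in X -> t x <= f x /\ x <= g (t x)).
Proof.
move=> sf sg tX; split=> [F _ /eta_onto[a ->]|F a].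
  by have := F a; rewrite !leq_restrict // !coordE.
by rewrite !leq_restrict // !coordE //; apply/F/eta_in.
Qed.

Lemma fits_coord f g t : stair n f -> stair n g -> t @: X = X -> fits f g t ->
  fits (restrict f) (restrict g) (coord X t).
Proof. by move=> sf sg tX F; apply/fits_coordP => // x _. Qed.

Lemma exists_restrict_top f g : stair n f -> stair n g -> good n f g ->
  exists s : 'S_#|X|, is_top (restrict f) (restrict g) s.
Proof.
move=> sf sg G; apply: exists_top; last exact: restrict_good.
  exact: restrict_stair.
exact: restrict_stair.
Qed.

End Restriction.

Lemma block_groupP n (P : {set {set 'I_n}}) (t : 'S_n) :
  reflect (forall X, X \in P -> t @: X = X) (t \in block_group P).
Proof.
rewrite inE; apply: (iffP forall_inP) => H X XP; last by rewrite H.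
exact/eqP/H.
Qed.

Lemma block_leP n (P : {set {set 'I_n}}) (t s : 'S_n) :
  t \in block_group P -> s \in block_group P ->
  reflect (forall X a b, X \in P -> rank_in X s a b <= rank_in X t a b)
          (block_le P t s).
Proof.
move=> /block_groupP tP /block_groupP sP; apply: (iffP forall_inP) => [H X a b XP|H X XP].
  exact: elimT (bruhat_coord (tP X XP) (sP X XP)) (H X XP) a b.
by apply/(bruhat_coord (tP X XP) (sP X XP)) => a b; apply: H.
Qed.

(** * Gluing permutations of disjoint blocks *)

Section Assembly.
Variables (n : nat) (P : {set {set 'I_n}}) (u : forall X : {set 'I_n}, 'S_#|X|).
Hypothesis tiP : trivIset P.
Implicit Types X : {set 'I_n}.

(** Points outside the cover of [P] stay fixed, so the family [[set X]] extends a permutation of one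
    block by the identity. *)
Definition assemble_fun (x : 'I_n) : 'I_n :=
  if [pick a : 'I_#|pblock P x| | eta a == x] is Some a then eta (u _ a) else x.

Lemma assemble_fun_eta X (a : 'I_#|X|) : X \in P ->
  assemble_fun (eta a) = eta (u X a).
Proof.
move=> XP; rewrite /assemble_fun (def_pblock tiP XP (eta_in a)).
by case: pickP => [b /eqP/eta_inj -> //|/(_ a)]; rewrite eqxx.
Qed.

Lemma assemble_fun_out x : x \notin cover P -> assemble_fun x = x.
Proof.
rewrite -mem_pblock /assemble_fun; case: pickP => // a /eqP E.
by have := eta_in a; rewrite E => ->.
Qed.

Lemma assemble_inj : injective assemble_fun.
Proof.
have inside x : x \in cover P -> exists2 X, X \in P & exists a : 'I_#|X|, x = eta a.
  by case/bigcupP=> X XP /eta_onto; exists X.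
have inC X (a : 'I_#|X|) : X \in P -> eta a \in cover P.
  by move=> XP; apply/bigcupP; exists X; rewrite // eta_in.
move=> x y; have [/inside[X XP [a ->]]|xP] := boolP (x \in cover P);
  have [/inside[Y YP [b ->]]|yP] := boolP (y \in cover P).
- rewrite !assemble_fun_eta // => E.
  have XY : X = Y.
    by rewrite -(def_pblock tiP XP (eta_in (u X a))) E (def_pblock tiP YP (eta_in _)).
  by subst Y; move: E => /eta_inj/perm_inj ->.
- rewrite assemble_fun_eta // (assemble_fun_out yP) => E.
  by rewrite -E inC in yP.
- rewrite assemble_fun_eta // (assemble_fun_out xP) => E.
  by rewrite E inC in xP.
- by rewrite !assemble_fun_out.
Qed.

Definition assemble : 'S_n := perm assemble_inj.

Lemma assemble_stable X : X \in P -> assemble @: X = X.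
Proof.
move=> XP; apply/eqP; rewrite eqEcard card_imset ?leqnn ?andbT; last exact: perm_inj.
apply/subsetP=> _ /imsetP[x /eta_onto[a ->] ->].
by rewrite permE assemble_fun_eta // eta_in.
Qed.

Lemma assemble_out x : x \notin cover P -> assemble x = x.
Proof. by rewrite permE; apply: assemble_fun_out. Qed.

Lemma coord_assemble X : X \in P -> coord X assemble = u X.
Proof.
move=> XP; apply/permP=> a; apply: (@eta_inj _ X).
by rewrite coordE ?assemble_stable // permE assemble_fun_eta.
Qed.

End Assembly.

(** * Smooth permutations have smooth block maxima *)

Section Forward.
Variables (n : nat) (sigma : 'S_n) (P : {set {set 'I_n}}).
Hypotheses (sm : smooth sigma) (partP : partition P [set: 'I_n]).
Let f := prefix_max sigma.
Let g := prefix_max sigma^-1.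

(** The maxima of the restricted regions are glued. The result lies in the region of [sigma], whose
    maximum is [sigma]. *)
Lemma smooth_block_max : exists2 mu : 'S_n, is_block_max P sigma mu &
  forall X, X \in P -> is_top (restrict X f) (restrict X g) (coord X mu).
Proof.
have sf : stair n f := prefix_max_stair _; have sg : stair n g := prefix_max_stair _.
have [u top_u] := fin_all_exists
  (fun X => exists_restrict_top X sf sg (smooth_good sm)).
have tiP := partition_trivIset partP; pose mu := assemble u tiP.
have topX X : X \in P -> is_top (restrict X f) (restrict X g) (coord X mu).
  by move=> XP; rewrite coord_assemble.
have [F M _ _ _] := smooth_is_top sm.
have muP : mu \in block_group P by apply/block_groupP=> X XP; exact: assemble_stable.
exists mu => //; split=> //.
  apply: M => x; have xP : x \in cover P by rewrite (cover_partition partP) inE.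
  have XP := pblock_mem xP; have [+ _ _ _ _] := topX _ XP.
  by move/fits_coordP; apply=> //; [exact: assemble_stable | rewrite mem_pblock].
move=> t /block_groupP tP ts; apply/forall_inP=> X XP; have [_ + _ _ _] := topX X XP.
apply; apply: fits_coord; rewrite ?tP //; exact: fits_lower ts F.
Qed.

(** Antisymmetry in each coordinate makes block maxima unique, so [mu] has the coordinates of the
    glued one. *)
Lemma smooth_block_smooth mu : is_block_max P sigma mu -> block_smooth P mu.
Proof.
move=> [muP mus max_mu]; have [nu [nuP nus max_nu] topX] := smooth_block_max.
apply/forall_inP=> X XP; have -> : coord X mu = coord X nu.
  apply: bruhat_anti; first by move/forall_inP: (max_nu mu muP mus) => ->.
  by move/forall_inP: (max_mu nu nuP nus) => ->.
by apply: is_top_smooth (topX X XP); exact: restrict_stair (prefix_max_stair _).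
Qed.

End Forward.

(** * Block maxima force a good region *)

Definition has_block_maxima (n : nat) (sigma : 'S_n) : Prop :=
  forall P : {set {set 'I_n}}, partition P [set: 'I_n] ->
    exists mu : 'S_n, is_block_max P sigma mu.

Section Stable.
Variable n : nat.
Implicit Types (s t : 'S_n) (X Y : {set 'I_n}).

Lemma stable_closed t X : (forall x, x \in X -> t x \in X) -> t @: X = X.
Proof.
move=> tX; apply/eqP; rewrite eqEcard card_imset ?leqnn ?andbT; last exact: perm_inj.
by apply/subsetP=> _ /imsetP[x xX ->]; apply: tX.
Qed.

Lemma stable_in t X x : t @: X = X -> (t x \in X) = (x \in X).
Proof. by move=> tX; rewrite -{1}tX (mem_imset _ _ (@perm_inj _ t)). Qed.

Lemma stableV t X : t @: X = X -> t^-1%g @: X = X.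
Proof.
by move=> tX; apply: stable_closed => x; rewrite -{1}[x](permKV t) stable_in.
Qed.

Lemma is_block_maxV P s mu : is_block_max P s mu -> is_block_max P s^-1 mu^-1.
Proof.
move=> [muP mus max_mu].
have invP t : t \in block_group P -> t^-1%g \in block_group P.
  by move=> /block_groupP tP; apply/block_groupP=> X /tP; exact: stableV.
split; [exact: invP | exact: bruhatV | move=> t tP ts].
apply/block_leP; rewrite ?invP // => X a b XP.
have /block_leP H : block_le P t^-1 mu.
  by apply: max_mu; [exact: invP | rewrite -[s]invgK; exact: bruhatV].
have := H (invP _ tP) muP X b a XP; move/block_groupP: muP => muP.
by move/block_groupP: tP => tP; rewrite !rank_inV ?tP ?muP.
Qed.

Lemma has_block_maximaV s : has_block_maxima s -> has_block_maxima s^-1.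
Proof. by move=> H P /H[mu /is_block_maxV]; exists mu^-1%g. Qed.

Lemma partition_setC X : partition ([set X; ~: X] :\ set0) [set: 'I_n].
Proof.
apply/and3P; split; last by rewrite !inE eqxx.
  rewrite eqEsubset subsetT /=; apply/subsetP=> x _; apply/bigcupP.
  have [xX|xX] := boolP (x \in X).
    by exists X; rewrite // !inE eqxx andbT; apply/set0Pn; exists x.
  exists (~: X); rewrite !inE ?eqxx ?orbT ?andbT //; apply/set0Pn; exists x.
  by rewrite inE.
apply: trivIsetD; apply/trivIsetP=> A B; rewrite !inE => /orP[]/eqP-> /orP[]/eqP->;
  rewrite ?eqxx // => _.
  by rewrite -setI_eq0 setICr.
by rewrite -setI_eq0 setIC setICr.
Qed.

Lemma setC_block_max s X : has_block_maxima s ->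
  exists mu : 'S_n, [/\ mu @: X = X, bruhat mu s &
    forall t, t @: X = X -> bruhat t s -> forall a b,
      rank_in X mu a b <= rank_in X t a b /\
      rank_in (~: X) mu a b <= rank_in (~: X) t a b].
Proof.
move/(_ _ (partition_setC X)) => [mu [muP mus max_mu]].
have rank_in0 t a b : rank_in set0 t a b = 0.
  by apply/eqP; rewrite cards_eq0; apply/eqP/setP=> x; rewrite !inE.
have groupE t : t @: X = X -> t \in block_group ([set X; ~: X] :\ set0).
  move=> tX; apply/block_groupP=> Y; rewrite !inE => /andP[_ /orP[]/eqP-> //].
  exact: stable_setC.
have muX : mu @: X = X.
  have [->|X0] := eqVneq X set0; first by rewrite imset0.
  by move/block_groupP: muP; apply; rewrite !inE X0 eqxx.
exists mu; split=> // t tX ts a b.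
have /block_leP H := max_mu t (groupE t tX) ts; move: H => /(_ (groupE t tX) muP) H.
have H' Y : (Y == X) || (Y == ~: X) -> rank_in Y mu a b <= rank_in Y t a b.
  move=> YX; have [->|Y0] := eqVneq Y set0; first by rewrite !rank_in0.
  by apply: H; rewrite !inE Y0.
by split; apply: H'; rewrite eqxx ?orbT.
Qed.

Lemma rank_split X t a b : rank t a b = rank_in X t a b + rank_in (~: X) t a b.
Proof.
rewrite /rank /rank_in -cardsUI [X in _ = _ + X](_ : _ = 0); last first.
  by apply/eqP; rewrite cards_eq0; apply/eqP/setP=> x; rewrite !inE; lia.
by rewrite addn0; apply: eq_card => x; rewrite !inE; case: (x \in X); rewrite ?orbF.
Qed.

Lemma rank_tperm_inv s (p q : 'I_n) a b : p < q -> s q < s p ->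
  rank (tperm p q * s)%g a b = rank s a b + [&& p < a, a <= q, s q < b & b <= s p].
Proof.
move=> pq sqp; have qp : q != p by rewrite -val_eqE /=; lia.
have split2 (F : 'I_n -> nat) :
    \sum_(k in [set: 'I_n]) F k = F p + (F q + \sum_(k | (k != p) && (k != q)) F k).
  rewrite (eq_bigl xpredT) => [|k]; last by rewrite inE.
  by rewrite (bigD1 p) //=; congr (_ + _); rewrite (bigD1 q).
rewrite /rank /rank_in !card_sum_in !split2 !permM tpermL tpermR.
rewrite [X in _ + (_ + X) = _](eq_bigr (fun k : 'I_n => nat_of_bool ((k < a) && (s k < b)))).
  by set r := (\sum_(_ | _) _); lia.
by move=> k /andP[kp kq]; rewrite permM tpermD 1?eq_sym.
Qed.

(* The cycle [i -> m -> m+1 -> ... -> u -> i], all of whose moves but one go up. *)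
Definition cycle_nat (i m u x : nat) : nat :=
  if x == u then i else if x == i then m else if m <= x < u then x.+1 else x.

Lemma exists_cycle i m u : i < m -> m <= u -> u < n ->
  exists c : 'S_n, forall x, c x = cycle_nat i m u x :> nat.
Proof.
move=> im mu un; have lt_n (x : 'I_n) : cycle_nat i m u x < n.
  by have := ltn_ord x; rewrite /cycle_nat; do 3 ?(case: ifP => ?); lia.
have inj : injective (fun x => Ordinal (lt_n x)).
  move=> x y /(congr1 val) /=; rewrite /cycle_nat => E; apply: val_inj => /=.
  by move: E; do 6 ?(case: ifP => ?); lia.
by exists (perm inj) => x; rewrite permE.
Qed.

Lemma near_id_cycle i m u (c : 'S_n) : i < m ->
  (forall x, c x = cycle_nat i m u x :> nat) -> near_id c.
Proof.
move=> im cE; have desc (k : 'I_n) : c k < k -> k = u :> nat.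
  by rewrite cE /cycle_nat; do 3 ?(case: ifP => ?); lia.
by apply: near_id_one_descent => k l /desc kE /desc lE; apply: val_inj; rewrite /= kE.
Qed.

Lemma fits_cycle f g i m u (c : 'S_n) : stair n f -> stair n g ->
  i < m -> m <= u -> u < n -> m <= f i -> u <= g i ->
  (forall x, m <= x < u -> x < f x) ->
  (forall x, c x = cycle_nat i m u x :> nat) -> fits f g c.
Proof.
move=> [f1 f2] [g1 g2] im mu un mf ug up cE x; rewrite cE /cycle_nat.
have xn := ltn_ord x; have := f1 x xn; have := g1 x xn.
case: eqP => [->|xu]; first by lia.
case: eqP => [->|xi]; first by have := g1 m; lia.
case: ifP => mxu; last by lia.
by have := up x mxu; have := g1 x.+1; lia.
Qed.

(* With m = M i and u = M' i, the maximum for the block {i} U [m, u+1] dominates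
   the cycles i -> m -> ... -> u -> i and m -> ... -> u+1 -> m, so it must send u
   to i and u+1 to m, which leaves no admissible value at i. *)
Lemma maxima_step s i j : has_block_maxima s ->
  let M := prefix_max s in let M' := prefix_max s^-1 in
  i <= j -> j < n -> j <= M i -> M i <= M' i -> M i < M j -> M' i < M' j -> False.
Proof.
move=> H M M' ij jn jM MM' lt_M lt_M'.
have sf : stair n M := prefix_max_stair _; have sg : stair n M' := prefix_max_stair _.
have [f1 f2] := sf; have [g1 g2] := sg.
have lt_ij : i < j by rewrite ltn_neqAle ij andbT; apply: contraTneq lt_M => ->; lia.
set m := M i in jM MM' lt_M *; set u := M' i in MM' lt_M' *.
have wn : u.+1 < n by have := g1 j jn; lia.
(* The point in column [M' j > u] has its row at most [j <= m], so [crossing] applies at every such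
   [x]. *)
have up x : m <= x < u.+1 -> x < M x.
  move=> mx; have [k kj kE] := prefix_max_attained s^-1 jn.
  rewrite -/M' in kE; have [] := @crossing _ s (s^-1 k)%g x; rewrite ?permKV; [lia|lia|].
  by move=> l lx xl; apply: leq_trans xl _; apply: prefix_max_geq.
have mn : m < n by lia.
have mM : m < M m by apply: leq_trans lt_M (f2 _ _ jM mn).
have wM' : u.+1 <= M' m by apply: leq_trans lt_M' (g2 _ _ jM mn).
have im : i < m by lia.
have [c1 c1E] := exists_cycle im MM' (ltnW wn).
have [c2 c2E] := exists_cycle (ltnSn m) (MM' : m.+1 <= u.+1) wn.
have c1s : bruhat c1 s.
  apply: near_bruhat (near_id_cycle im c1E) _; apply: fits_cycle c1E => //; first by lia.
  by move=> x mx; apply: up; lia.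
have c2s : bruhat c2 s.
  apply: near_bruhat (near_id_cycle (ltnSn m) c2E) _; apply: fits_cycle c2E => //.
  by move=> x mx; apply: up; lia.
pose X := [set x : 'I_n | (x == i :> nat) || (m <= x <= u.+1)].
have XE x : (x \in X) = (x == i :> nat) || (m <= x <= u.+1) by rewrite inE.
have c1X : c1 @: X = X.
  apply: stable_closed => x; rewrite !XE c1E /cycle_nat.
  by do 3 ?(case: ifP => ?); lia.
have c2X : c2 @: X = X.
  apply: stable_closed => x; rewrite !XE c2E /cycle_nat.
  by do 3 ?(case: ifP => ?); lia.
have [mu [muX mus max_mu]] := setC_block_max X H.
have Fmu : fits M M' mu.
  by apply: fits_lower mus _; [exact: sf | exact: sg | exact: fits_prefix_max].
have i_n : i < n by lia.
pose I := Ordinal i_n; pose Mo := Ordinal mn.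
pose y := (mu^-1 I)%g; pose z := (mu^-1 Mo)%g.
have yX : y \in X by rewrite -(stable_in y muX) permKV XE eqxx.
have zX : z \in X by rewrite -(stable_in z muX) permKV XE /=; lia.
(* Up to row [i], [c1] has no point over [X] left of column [u], hence neither has [mu]; and
   [M' i = u] keeps row [i] from going further right. *)
have yE : y = u :> nat.
  have : y <= u by have [_] := Fmu y; rewrite permKV.
  suff : ~~ (y < u) by lia.
  apply/negP=> yu; have [+ _] := max_mu c1 c1X c1s u i.+1.
  have -> : rank_in X c1 u i.+1 = 0.
    apply/eqP; rewrite cards_eq0; apply/eqP/setP=> x; rewrite !inE c1E /cycle_nat.
    by apply/negbTE; do 3 ?(case: ifP => ?); lia.
  rewrite leqn0 cards_eq0 => /eqP/setP/(_ y); rewrite !inE yu permKV ltnSn /= andbT.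
  by rewrite -XE yX.
(* Left of column [u.+1] and up to row [m], [c2] has only the fixed point [i] over [X], while [mu]
   would have both [y] and [z]. *)
have zE : u.+1 <= z.
  rewrite leqNgt; apply/negP=> zu; have [+ _] := max_mu c2 c2X c2s u.+1 m.+1.
  rewrite leqNgt => /negP; apply; apply: (@leq_ltn_trans 1).
    rewrite -(cards1 I); apply: subset_leq_card; apply/subsetP=> x.
    rewrite !inE c2E /cycle_nat -val_eqE /=; do 3 ?(case: ifP => ?); lia.
  apply/card_gt1P; exists y, z; split.
  - by rewrite inE yX permKV yE /=; lia.
  - by rewrite inE zX permKV zu /=.
  - by apply: contraTneq im => /perm_inj/(congr1 val) /= ->; rewrite ltnn.
have IX : mu I \in X by rewrite stable_in // XE eqxx.
have muI : mu I != i :> nat.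
  apply/negP=> /eqP E; have : I = y by rewrite -[I](permK mu); congr ((mu^-1)%g _); exact: val_inj.
  by move/(congr1 val); rewrite /= yE; lia.
have muM : mu I != m :> nat.
  apply/negP=> /eqP E; have : I = z by rewrite -[I](permK mu); congr ((mu^-1)%g _); exact: val_inj.
  by move/(congr1 val) => /=; lia.
by have [] := Fmu I; move: IX; rewrite XE /=; lia.
Qed.

Lemma maxima_good s : has_block_maxima s -> good n (prefix_max s) (prefix_max s^-1).
Proof.
move=> H i j ij jn jM jM'.
have [_ f2] := prefix_max_stair s; have [_ g2] := prefix_max_stair s^-1.
have := f2 i j ij jn; have := g2 i j ij jn.
rewrite leq_eqVlt => /orP[/eqP->|lt_M']; first by right.
rewrite leq_eqVlt => /orP[/eqP->|lt_M]; first by left.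
exfalso; have [le|/ltnW le] := leqP (prefix_max s i) (prefix_max s^-1 i).
  exact: (@maxima_step s i j).
by apply: (@maxima_step s^-1 i j) => //; rewrite ?invgK //; exact: has_block_maximaV.
Qed.

Lemma porbit_stable t x : t @: porbit t x = porbit t x.
Proof.
apply: stable_closed => y; rewrite -!eq_porbit_mem => /eqP<-.
by rewrite -(porbit_perm t 1 y) expg1.
Qed.

(** If [p] and [q] shared an orbit in both permutations, multiplying by [tperm p q] twice would
    raise the number of orbits twice and yet return to [t]. *)
Lemma split_orbit t (p q : 'I_n) : p != q ->
  (q \notin porbit t p) || (q \notin porbit (tperm p q * t)%g p).
Proof.
move=> pq; rewrite -negb_and; apply/negP=> /andP[h1 h2].
have := porbits_mul_tperm (tperm p q * t)%g p q.
have := porbits_mul_tperm t p q.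
rewrite /= mulgA tperm2 mul1g pq (porbit_sym t) h1 (porbit_sym (_ * t)%g) h2 /=.
by rewrite !addn0 => -> /eqP; rewrite -addnA -{1}[#|_|]addn0 eqn_add2l.
Qed.

End Stable.

Lemma card_gt1_lt n (A : {set 'I_n}) : 1 < #|A| ->
  exists x y : 'I_n, [/\ x \in A, y \in A & x < y].
Proof.
case/card_gt1P=> x [y [xA yA]]; case: (ltngtP x y) => [xy|yx|/val_inj->].
- by exists x, y.
- by exists y, x.
- by rewrite eqxx.
Qed.

(** * Block maxima put the whole region below [s] *)

Section Maxima.
Variables (n : nat) (s : 'S_n).
Hypothesis maxima : has_block_maxima s.
Let f := prefix_max s.
Let g := prefix_max s^-1.
Let sf : stair n f := prefix_max_stair _.
Let sg : stair n g := prefix_max_stair _.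
Let G : good n f g := maxima_good maxima.
Implicit Types (t : 'S_n) (X Y Z : {set 'I_n}).

Definition fixes_outside X t : Prop := forall x, x \notin X -> t x = x.

Lemma fixes_outside_stable X t : fixes_outside X t -> t @: X = X.
Proof.
move=> out; apply: stable_closed => x xX; apply: contraLR xX => txX.
by have := out _ txX; move/perm_inj => <-.
Qed.

Lemma restr_in Y t x : t @: Y = Y -> x \in Y -> restr_perm Y t x = t x.
Proof.
move=> tY xY; rewrite restr_permE //.
by apply/astabsP=> y; rewrite /= apermE stable_in.
Qed.

Lemma restr_out Y t x : x \notin Y -> restr_perm Y t x = x.
Proof. by move=> xY; rewrite (out_perm (restr_perm_on Y t)). Qed.

Lemma restr_stable Y t : restr_perm Y t @: Y = Y.
Proof. by apply: fixes_outside_stable => x; apply: restr_out. Qed.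

Lemma restr_fits Y t : t @: Y = Y -> fits f g t -> fits f g (restr_perm Y t).
Proof.
move=> tY F x; have [xY|xY] := boolP (x \in Y); first by rewrite restr_in.
rewrite restr_out //; have [f1 _] := sf; have [g1 _] := sg.
by have := f1 x (ltn_ord x); have := g1 x (ltn_ord x); lia.
Qed.

Lemma eq_rank_in Y t t' a b : {in Y, t =1 t'} -> rank_in Y t a b = rank_in Y t' a b.
Proof.
move=> E; apply: eq_card => x; rewrite !inE.
by have [xY|//] := boolP (x \in Y); rewrite E.
Qed.

(** The restrictions of [t] to [Y] and its complement have smaller support, so they are below [s],
    and the maximum for these two blocks dominates each on its block. Adding ranks puts [t] below
    that maximum. *)
Lemma splitting_bruhat X Y t (x y : 'I_n) :
  (forall Z, #|Z| < #|X| -> forall t', fits f g t' -> fixes_outside Z t' -> bruhat t' s) ->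
  fits f g t -> fixes_outside X t -> t @: Y = Y ->
  x \in X -> x \notin Y -> y \in X -> y \in Y -> bruhat t s.
Proof.
move=> IH F out tY xX xY yX yY; have tY' := stable_setC tY.
have sub Z z : t @: Z = Z -> z \in X -> z \notin Z -> bruhat (restr_perm Z t) s.
  move=> tZ zX zZ; apply: (IH (X :&: Z)); last 2 first.
  - exact: restr_fits.
  - move=> w; rewrite inE negb_and => /orP[wX|wZ]; last by rewrite restr_out.
    have [wZ|wZ] := boolP (w \in Z); last by rewrite restr_out.
    by rewrite restr_in // out.
  apply: proper_card; apply/properP; split; first exact: subsetIl.
  by exists z => //; rewrite inE zX.
have [mu [muY mus max_mu]] := setC_block_max Y maxima.
apply: bruhat_trans mus; apply/bruhatP=> a b; rewrite !(rank_split Y).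
apply: leq_add.
  rewrite -(@eq_rank_in Y (restr_perm Y t) t) => [|z]; last exact: restr_in.
  exact: (max_mu _ (restr_stable Y t) (sub _ _ tY xX xY) a b).1.
rewrite -(@eq_rank_in (~: Y) (restr_perm (~: Y) t) t) => [|z]; last exact: restr_in.
have r1 : restr_perm (~: Y) t @: Y = Y.
  by have := stable_setC (restr_stable (~: Y) t); rewrite setCK.
by apply: (max_mu _ r1 (sub _ _ tY' yX _) a b).2; rewrite inE yY.
Qed.

Lemma avoiding_bruhat X nu :
  (forall Z, #|Z| < #|X| -> forall t, fits f g t -> fixes_outside Z t -> bruhat t s) ->
  fits f g nu -> fixes_outside X nu -> avoids3412 (coord X nu) -> bruhat nu s.
Proof.
move=> IH F out av; have nuX := fixes_outside_stable out.
have split_by (p q : 'I_n) t : fits f g t -> fixes_outside X t -> p \in X -> q \in X ->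
    q \notin porbit t p -> bruhat t s.
  move=> Ft outt pX qX qp.
  exact: (splitting_bruhat IH Ft outt (porbit_stable t p) qX qp pX (porbit_id _ _)).
have [|] := boolP [exists p in X, exists q in X, (p != q) && (q \notin porbit nu p)].
  case/exists_inP=> p pX /exists_inP[q qX /andP[pq qp]]; exact: (split_by p q).
(* Now [X] lies in one orbit of [nu], so each [tperm p q * nu] splits it. *)
move=> cyc; have swap (p q : 'I_n) : p \in X -> q \in X -> p < q -> nu q < nu p ->
    bruhat (tperm p q * nu)%g s.
  move=> pX qX pq inv; have pq' : p != q by rewrite -val_eqE /=; lia.
  apply: (split_by p q) => //.
  - apply: fits_lower F => //; apply/bruhatP=> a b.
    by rewrite rank_tperm_inv //; apply: leq_addr.
  - move=> x xX; rewrite permM tpermD ?out //.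
      by apply: contraNneq xX => <-.
    by apply: contraNneq xX => <-.
  have /orP[qp|//] := split_orbit nu pq'; case/negP: cyc.
  by apply/exists_inP; exists p => //; apply/exists_inP; exists q; rewrite // pq' qp.
apply/bruhatP=> a b.
(* If [a], [b] lies outside the rectangle of some inversion, undoing that inversion keeps the rank
   there. *)
have [|inside] := boolP [exists p in X, exists q in X, [&& p < q, nu q < nu p &
    ~~ [&& p < a, a <= q, nu q < b & b <= nu p]]].
  case/exists_inP=> p pX /exists_inP[q qX /and3P[pq inv win]].
  have /bruhatP/(_ a b) := swap p q pX qX pq inv.
  by rewrite rank_tperm_inv // (negbTE win) addn0.
have window (p q : 'I_n) : p \in X -> q \in X -> p < q -> nu q < nu p ->
    [&& p < a, a <= q, nu q < b & b <= nu p].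
  move=> pX qX pq inv; apply: contraNT inside => win.
  by apply/exists_inP; exists p => //; apply/exists_inP; exists q; rewrite // pq inv.
(* Every inversion now surrounds [a], [b], so values increase along [upper_in] and along [lower_in];
   two points in each would form 3412. *)
have thin : ~ (1 < #|upper_in X nu a b| /\ 1 < #|lower_in X nu a b|).
  case=> /card_gt1_lt[p [p' [+ + pp']]] /card_gt1_lt[q [q' [+ + qq']]].
  rewrite !inE => /and3P[pX pa bp] /and3P[p'X p'a bp'] /and3P[qX aq qb] /and3P[q'X aq' q'b].
  have up : nu p < nu p'.
    rewrite ltn_neqAle leqNgt; apply/andP; split.
      by rewrite (inj_eq val_inj) (inj_eq perm_inj) -val_eqE /=; lia.
    by apply/negP=> /(window p p' pX p'X pp'); lia.
  have up' : nu q < nu q'.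
    rewrite ltn_neqAle leqNgt; apply/andP; split.
      by rewrite (inj_eq val_inj) (inj_eq perm_inj) -val_eqE /=; lia.
    by apply/negP=> /(window q q' qX q'X qq'); lia.
  have [c E] := eta_onto pX; subst p; have [c' E] := eta_onto p'X; subst p'.
  have [e E] := eta_onto qX; subst q; have [e' E] := eta_onto q'X; subst q'.
  apply: (av c c' e e'); rewrite -?(eta_mono c) -?(eta_mono c') -?(eta_mono e) -1?eta_mono ?coordE //; lia.
(* A deficit of two at [a'], [b'] gives two points on each side. Pairs from opposite sides are
   inversions, so all these points are also in [upper_in] and [lower_in] at [a], [b]. *)
have near : near_id nu.
  move=> a' b' an bn; rewrite leqNgt; apply/negP=> low; apply: thin.
  have U : 1 < #|upper_in X nu a' b'| /\ 1 < #|lower_in X nu a' b'|.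
    have := rank_in_upper X nu a' b'; have := rank_in_lower a' b' nuX.
    have := rank_upper nu a' b'; have := rank_lower nu a' b'.
    case: (leqP a' b') => ab.
      have -> : upper_in setT nu a' b' = upper_in X nu a' b'.
        apply/setP=> k; rewrite !inE /=; have [//|kX] := boolP (k \in X).
        by rewrite out //; lia.
      by have := below_mono X ab; lia.
    have -> : lower_in setT nu a' b' = lower_in X nu a' b'.
      apply/setP=> k; rewrite !inE /=; have [//|kX] := boolP (k \in X).
      by rewrite out //; lia.
    by have := below_mono X (ltnW ab); lia.
  case: U => U L; have [p0 p0U] : exists p, p \in upper_in X nu a' b'.
    by apply/card_gt0P; lia.
  have [q0 q0L] : exists q, q \in lower_in X nu a' b' by apply/card_gt0P; lia.
  have win p q : p \in upper_in X nu a' b' -> q \in lower_in X nu a' b' ->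
      [&& p < a, a <= q, nu q < b & b <= nu p].
    by rewrite !inE => /and3P[pX pa bp] /and3P[qX aq qb]; apply: window => //; lia.
  split.
    apply: leq_trans U _; apply: subset_leq_card; apply/subsetP=> p pU.
    by have := win p q0 pU q0L; move: pU; rewrite !inE => /and3P[-> _ _]; lia.
  apply: leq_trans L _; apply: subset_leq_card; apply/subsetP=> q qL.
  by have := win p0 q p0U qL; move: qL; rewrite !inE => /and3P[-> _ _]; lia.
by move/bruhatP: (near_bruhat near F).
Qed.

(** Induction on [#|X|]: [nu] extends the maximum of the region restricted to [X] by the identity.
    It dominates [t] and avoids 3412 on [X], so [avoiding_bruhat] applies to it. *)
Lemma fits_bruhat X t : fits f g t -> fixes_outside X t -> bruhat t s.
Proof.
have [k] := ubnP #|X|; elim: k X t => // k IH X t Xk Ft outt.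
have [u top_u] := fin_all_exists (fun Y => exists_restrict_top Y sf sg G).
pose nu := assemble u (trivIset1 X); have XX : X \in [set X] by rewrite inE.
have out : fixes_outside X nu.
  by move=> x xX; apply: assemble_out; rewrite cover1.
have nuX := fixes_outside_stable out; have tX := fixes_outside_stable outt.
have cE : coord X nu = u X by apply: coord_assemble.
have [Fu M _ _ A] := top_u X.
have Fnu : fits f g nu.
  move=> x; have [xX|xX] := boolP (x \in X).
    by move: x xX; apply/fits_coordP => //; rewrite cE.
  rewrite out //; have [f1 _] := sf; have [g1 _] := sg.
  by have := f1 x (ltn_ord x); have := g1 x (ltn_ord x); lia.
apply: bruhat_trans (_ : bruhat nu s).
  have := M _ (fits_coord sf sg tX Ft); rewrite -cE => /(bruhat_coord tX nuX) H.
  apply/bruhatP=> a b; rewrite !(rank_split X) leq_add //.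
  by rewrite (@eq_rank_in (~: X) nu t) // => x; rewrite inE => xX; rewrite out ?outt.
apply: (@avoiding_bruhat X) => //; last by rewrite cE.
by move=> Z ZX t'; apply: IH; apply: leq_trans ZX _.
Qed.

Lemma maxima_smooth : smooth s.
Proof.
have [w top] := exists_top sf sg G; have [Fw M _ _ _] := top.
have -> : s = w.
  apply: bruhat_anti; first exact/M/fits_prefix_max.
  by apply: (@fits_bruhat setT) => // x; rewrite inE.
exact: is_top_smooth top.
Qed.

End Maxima.

Theorem theorem1p3 (n : nat) (n_gt0 : 0 < n) (sigma : 'S_n) :
  (smooth sigma <->
   forall P : {set {set 'I_n}}, partition P [set: 'I_n] ->
     exists mu : 'S_n, is_block_max P sigma mu) /\
  (smooth sigma ->
   forall P : {set {set 'I_n}}, partition P [set: 'I_n] ->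
     forall mu : 'S_n, is_block_max P sigma mu -> block_smooth P mu).
Proof.
split; last by move=> sm P partP mu; apply: smooth_block_smooth.
split=> [sm P partP|]; last exact: maxima_smooth.
by have [mu mu_max _] := smooth_block_max sm partP; exists mu.
Qed.
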